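(* Let $T$ be a complete Heyting algebra. Then the category of $T$-sets (whose objects are the pairs $(A,\mathrm{Id})$ in which every atom is real, and whose morphisms are the relations between such objects, as defined in the context) is an elementary topos. In particular, it has pull-backs and exponentials.
   Context: Complete Heyting algebra: a partially ordered set $(T,\le)$ with minimal element $\mu$, maximal element $M$, binary meets $p\wedge q$, and a least upper bound $\Sigma S\in T$ for every subset $S\subseteq T$, such that $(\Sigma S)\wedge b=\Sigma\{a\wedge b\mid a\in S\}$ for all $S\subseteq T$ and $b\in T$. Consider pairs $(A,\mathrm{Id})$ where $A$ is a set and $\mathrm{Id}:A\times A\to T$ is a function satisfying $\mathrm{Id}(x,y)=\mathrm{Id}(y,x)$ and $\mathrm{Id}(x,y)\wedge\mathrm{Id}(y,z)\le\mathrm{Id}(x,z)$ for all $x,y,z\in A$. Write $\mathrm{E}x=\mathrm{Id}(x,x)$. An atom of $(A,\mathrm{Id})$ is a function $a:A\to T$ such that for all $x,y\in A$: (A1) $a(x)\wedge\mathrm{Id}(x,y)\le a(y)$, and (A2) $a(x)\wedge a(y)\le\mathrm{Id}(x,y)$. An atom $a$ is real if there exists $x\in A$ such that $a(y)=\mathrm{Id}(x,y)$ for all $y\in A$. A $T$-set (object) is such a pair $(A,\mathrm{Id})$ in which every atom is real. Convention: elements of $A$ are identified with the atoms they represent, i.e. if $\mathrm{Id}(x,y)=\mathrm{Id}(x',y)$ for all $y\in A$, then $x=x'$. Equivalently, the relation on $A$ given by $a\le b$ if and only if $\mathrm{E}a=\mathrm{Id}(a,b)$ is antisymmetric. Localisation: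 for $x\in A$ and $p\in T$, the function $y\mapsto\mathrm{Id}(x,y)\wedge p$ is an atom. The localisation $x\restriction p$ is the element of $A$ representing it, so $\mathrm{Id}(x\restriction p,y)=\mathrm{Id}(x,y)\wedge p$ for all $y\in A$. A relation (morphism) from $(A,\mathrm{Id}_\alpha)$ to $(B,\mathrm{Id}_\beta)$ is a map $\rho:A\to B$ such that $\mathrm{E}_\beta\,\rho(a)=\mathrm{E}_\alpha\,a$ and $\rho(a\restriction p)=\rho(a)\restriction p$ for all $a\in A$, $p\in T$. Composition is composition of maps. An elementary topos is a category with finite limits (equivalently, pull-backs and a terminal object) that is Cartesian closed and has a subobject classifier. *)

(* Defs.v *)
From HB Require Import structures.
From mathcomp Require Import all_boot all_order.
From mathcomp Require Import boolp classical_sets functions.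
From Stdlib Require FinFun.

Set Implicit Arguments.
Unset Strict Implicit.
Unset Printing Implicit Defensive.

Import Order.TTheory.
Local Open Scope classical_set_scope.
Local Open Scope order_scope.

(** * Complete Heyting algebras *)

HB.mixin Record isCompleteHeyting d T of Order.TBMeetSemilattice d T := {
  bigjoin : set T -> T;
  bigjoin_supremum : forall S : set T, supremums S (bigjoin S);
  bigjoin_meetl : forall (S : set T) (b : T),
    Order.meet (bigjoin S) b = bigjoin [set Order.meet a b | a in S];
}.

#[short(type="completeHeytingType")]
HB.structure Definition CompleteHeyting d :=
  { T of isCompleteHeyting d T & Order.TBMeetSemilattice d T }.

(** * T-sets *)

Definition is_atom (d : Order.disp_t) (T : completeHeytingType d) (A : Type)
    (Id : A -> A -> T) (a : A -> T) : Prop :=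
  (forall x y, Order.meet (a x) (Id x y) <= a y) /\
  (forall x y, Order.meet (a x) (a y) <= Id x y).

Definition is_real (d : Order.disp_t) (T : completeHeytingType d) (A : Type)
    (Id : A -> A -> T) (a : A -> T) : Prop :=
  exists x, forall y, a y = Id x y.

(* [Id_inj] is the convention that elements are identified with the atoms
   they represent. *)
Record Tset (d : Order.disp_t) (T : completeHeytingType d) := TSet {
  Tcarrier :> Type;
  Id : Tcarrier -> Tcarrier -> T;
  Id_sym : forall x y, Id x y = Id y x;
  Id_trans : forall x y z, Order.meet (Id x y) (Id y z) <= Id x z;
  Id_real : forall a : Tcarrier -> T, is_atom Id a -> is_real Id a;
  Id_inj : forall x x', (forall y, Id x y = Id x' y) -> x = x'
}.

Definition extent (d : Order.disp_t) (T : completeHeytingType d) (A : Tset T)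
  (x : A) : T := Id x x.

Lemma is_atom_meet (d : Order.disp_t) (T : completeHeytingType d) (A : Tset T)
    (x : A) (p : T) : is_atom (@Id d T A) (fun y => Order.meet (Id x y) p).
Proof.
split=> y z.
- by rewrite meetAC leI2 ?Id_trans.
- apply: le_trans (Id_trans y x z).
  by rewrite leI2 ?leIl // [leRHS]Id_sym leIl.
Qed.

Definition restr (d : Order.disp_t) (T : completeHeytingType d) (A : Tset T)
    (x : A) (p : T) : A :=
  projT1 (cid (Id_real (is_atom_meet x p))).

Lemma Id_restr (d : Order.disp_t) (T : completeHeytingType d) (A : Tset T)
    (x : A) (p : T) (y : A) : Id (restr x p) y = Order.meet (Id x y) p.
Proof. by rewrite /restr; case: cid => z /= ->. Qed.

Record relation (d : Order.disp_t) (T : completeHeytingType d)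
    (A B : Tset T) := Relation {
  rel_fun :> A -> B;
  rel_extent : forall a, extent (rel_fun a) = extent a;
  rel_restr : forall a p, rel_fun (restr a p) = restr (rel_fun a) p
}.

Lemma relation_ext (d : Order.disp_t) (T : completeHeytingType d)
    (A B : Tset T) (r s : relation A B) : (r : A -> B) = s -> r = s.
Proof.
case: r s => [r r1 r2] [s s1 s2] /= rs; case: s / rs s1 s2 => s1 s2.
by congr Relation; exact: Prop_irrelevance.
Qed.

Definition relation_id (d : Order.disp_t) (T : completeHeytingType d)
    (A : Tset T) : relation A A :=
  @Relation d T A A (fun x => x) (fun=> erefl) (fun _ _ => erefl).

Definition relation_comp (d : Order.disp_t) (T : completeHeytingType d)
    (A B C : Tset T) (s : relation B C) (r : relation A B) : relation A C :=
  @Relation d T A C (fun x => s (r x))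
    (fun a => etrans (rel_extent s (r a)) (rel_extent r a))
    (fun a p => etrans (congr1 s (rel_restr r a p)) (rel_restr s (r a) p)).

(** * Categories and elementary toposes *)

Record category := Category {
  ob :> Type;
  hom : ob -> ob -> Type;
  idm : forall a, hom a a;
  comp : forall a b c, hom b c -> hom a b -> hom a c;
  comp_idl : forall a b (f : hom a b), comp (idm b) f = f;
  comp_idr : forall a b (f : hom a b), comp f (idm a) = f;
  compA : forall a b c e (h : hom c e) (g : hom b c) (f : hom a b),
    comp h (comp g f) = comp (comp h g) f
}.

Record functor (J C : category) := Functor {
  fob :> J -> C;
  fmap : forall i j, hom i j -> hom (fob i) (fob j);
  fmap_id : forall i, fmap (idm i) = idm (fob i);
  fmap_comp : forall i j k (v : hom j k) (u : hom i j),
    fmap (comp v u) = comp (fmap v) (fmap u)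
}.

Definition is_cone (J C : category) (F : functor J C) (X : C)
    (f : forall j, hom X (F j)) : Prop :=
  forall i j (u : hom i j), comp (fmap F u) (f i) = f j.

Definition is_limit (J C : category) (F : functor J C) (L : C)
    (p : forall j, hom L (F j)) : Prop :=
  is_cone p /\
  forall (X : C) (f : forall j, hom X (F j)), is_cone f ->
    exists! h : hom X L, forall j, comp (p j) h = f j.

(* [finite_set] would force the universe of [ob], hence that of the carriers
   of T-sets, below [predArgType]; [FinFun.Finite] (some list contains every
   element) does not. *)
Definition finite_category (J : category) : Prop :=
  FinFun.Finite (ob J) /\ forall i j : J, FinFun.Finite (hom i j).

Definition has_finite_limits (C : category) : Prop :=
  forall (J : category) (F : functor J C), finite_category J ->
    exists (L : C) (p : forall j, hom L (F j)), is_limit p.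

Definition is_terminal (C : category) (t : C) : Prop :=
  forall X : C, exists! h : hom X t, True.

Definition is_pullback (C : category) (X Y Z P : C) (f : hom X Z) (g : hom Y Z)
    (p : hom P X) (q : hom P Y) : Prop :=
  comp f p = comp g q /\
  forall (W : C) (u : hom W X) (v : hom W Y), comp f u = comp g v ->
    exists! h : hom W P, comp p h = u /\ comp q h = v.

Definition has_pullbacks (C : category) : Prop :=
  forall (X Y Z : C) (f : hom X Z) (g : hom Y Z),
    exists (P : C) (p : hom P X) (q : hom P Y), is_pullback f g p q.

Definition is_product (C : category) (X Y P : C) (p : hom P X) (q : hom P Y)
    : Prop :=
  forall (W : C) (u : hom W X) (v : hom W Y),
    exists! h : hom W P, comp p h = u /\ comp q h = v.

Definition has_terminal (C : category) : Prop :=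
  exists t : C, is_terminal t.

Definition has_binary_products (C : category) : Prop :=
  forall X Y : C, exists (P : C) (p : hom P X) (q : hom P Y), is_product p q.

(* [E] is an exponential of [Y] by [X], with evaluation [ev] defined on a
   product [P] of [E] and [X]: any [f : W x X -> Y] is [ev \o (g x id)] for
   a unique [g].  No choice of products is fixed: [Q] ranges over all products
   of [W] and [X], and [h] is [g x id : Q -> P]. *)
Definition is_exponential (C : category) (X Y E P : C) (p1 : hom P E)
    (p2 : hom P X) (ev : hom P Y) : Prop :=
  is_product p1 p2 /\
  forall (W Q : C) (q1 : hom Q W) (q2 : hom Q X), is_product q1 q2 ->
  forall f : hom Q Y,
    exists! g : hom W E, exists h : hom Q P,
      [/\ comp p1 h = comp g q1, comp p2 h = q2 & comp ev h = f].

Definition has_exponentials (C : category) : Prop :=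
  forall X Y : C, exists (E P : C) (p1 : hom P E) (p2 : hom P X) (ev : hom P Y),
    is_exponential p1 p2 ev.

Definition cartesian_closed (C : category) : Prop :=
  [/\ has_terminal C, has_binary_products C & has_exponentials C].

Definition is_monic (C : category) (X Y : C) (m : hom X Y) : Prop :=
  forall (W : C) (u v : hom W X), comp m u = comp m v -> u = v.

Definition is_subobject_classifier (C : category) (one Omega : C)
    (tr : hom one Omega) : Prop :=
  is_terminal one /\
  forall (U X : C) (m : hom U X) (bang : hom U one), is_monic m ->
    exists! chi : hom X Omega, is_pullback chi tr m bang.

Definition has_subobject_classifier (C : category) : Prop :=
  exists (one Omega : C) (tr : hom one Omega), is_subobject_classifier tr.

Definition elementary_topos (C : category) : Prop :=
  [/\ has_finite_limits C, cartesian_closed C & has_subobject_classifier C].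

(** * The category of T-sets *)

Definition Tset_category (d : Order.disp_t) (T : completeHeytingType d)
    : category :=
  @Category (Tset T) (@relation d T) (@relation_id d T) (@relation_comp d T)
    (fun A B r => relation_ext
      (erefl : relation_comp (relation_id B) r = r :> (A -> B)))
    (fun A B r => relation_ext
      (erefl : relation_comp r (relation_id A) = r :> (A -> B)))
    (fun A B C D t s r => relation_ext
      (erefl : relation_comp t (relation_comp s r) =
               relation_comp (relation_comp t s) r :> (A -> D))).

(* Main.v *)
Require Import Defs.
From mathcomp Require Import all_boot all_order.
From mathcomp Require Import boolp classical_sets functions.
From Stdlib Require FinFun List.

Set Implicit Arguments.
Unset Strict Implicit.
Unset Printing Implicit Defensive.

Import Defs Order.TTheory.
Local Open Scope classical_set_scope.
Local Open Scope order_scope.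

(** A T-set is the same thing as a sheaf of partial sections over T: the
    elements are sections, [extent] gives their domain and [restr] their
    restriction; that every atom is real means that compatible families glue,
    and [Id x y] is the largest domain on which [x] and [y] agree.  A relation
    is then a map preserving domains and restrictions.  Limits are the T-sets of
    compatible families with a common domain, the exponential consists of the
    partial morphisms defined over some [p], and the subobject classifier
    consists of the pairs [p <= e] with domain [e]; all of them are sheaves
    because gluing is done pointwise.  Pullbacks and products are characterized
    on elements, so that no choice of limits matters. *)

(** * Joins in a complete Heyting algebra *)

Section BigJoin.
Variables (d : Order.disp_t) (T : completeHeytingType d).
Implicit Types (S : set T) (p q : T).

Lemma bigjoin_ub S p : S p -> p <= bigjoin S.
Proof. by case: (bigjoin_supremum S) => + _ => /[apply]. Qed.

Lemma bigjoin_le S q : (forall p, S p -> p <= q) -> bigjoin S <= q.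
Proof. by case: (bigjoin_supremum S) => _ + Sq => /(_ q); apply. Qed.

Lemma bigjoin_meet_le S q r :
  (forall p, S p -> p `&` q <= r) -> bigjoin S `&` q <= r.
Proof.
by move=> Sqr; rewrite bigjoin_meetl; apply: bigjoin_le => _ [p /Sqr + <-].
Qed.

Lemma bigjoin_range_meet I (f : I -> T) q :
  bigjoin (range f) `&` q = bigjoin (range (fun i => f i `&` q)).
Proof. by rewrite bigjoin_meetl image_comp. Qed.

Lemma eq_of_le (p q : T) : (forall r, (r <= p) = (r <= q)) -> p = q.
Proof. by move=> pq; apply/le_anti; rewrite -pq lexx pq lexx. Qed.

End BigJoin.

(** * T-sets and sheaves *)

Section TsetTheory.
Variables (d : Order.disp_t) (T : completeHeytingType d).
Implicit Types (A B : Tset T).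

Lemma Id_le_extent A (x y : A) : Id x y <= extent x.
Proof. by rewrite -[leLHS]meetxx {2}Id_sym Id_trans. Qed.

Lemma extent_restr A (x : A) p : extent (restr x p) = extent x `&` p.
Proof.
by rewrite /extent Id_restr Id_sym Id_restr -meetA meetxx.
Qed.

Lemma restr_restr A (x : A) p q : restr (restr x p) q = restr x (p `&` q).
Proof. by apply: Id_inj => y; rewrite !Id_restr meetA. Qed.

Lemma restr_ge A (x : A) p : extent x <= p -> restr x p = x.
Proof.
move=> xp; apply: Id_inj => y; rewrite Id_restr.
by apply/meet_idPl/(le_trans (Id_le_extent x y)).
Qed.

Lemma restr_extent A (x : A) : restr x (extent x) = x.
Proof. exact: restr_ge. Qed.

(** Separation: by distributivity, [Id x w] met with [bigjoin S] is the join of its meets with the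
    members of [S]. *)
Lemma restr_bigjoin A (S : set T) (x y : A) :
  (forall p, S p -> restr x p = restr y p) ->
  restr x (bigjoin S) = restr y (bigjoin S).
Proof.
move=> xy; apply: Id_inj => w; rewrite !Id_restr.
rewrite !(meetC _ (bigjoin S)) !bigjoin_meetl; congr bigjoin.
apply: eq_imagel => p Sp; rewrite !(meetC p).
by have := congr1 (fun z => Id z w) (xy p Sp); rewrite !Id_restr.
Qed.

Lemma eq_local A (S : set T) (x y : A) :
  extent x <= bigjoin S -> extent y <= bigjoin S ->
  (forall p, S p -> restr x p = restr y p) -> x = y.
Proof. by move=> xS yS xy; have := restr_bigjoin xy; rewrite !restr_ge. Qed.

(** The join of the atoms [Id (s i)] is again an atom, compatibility giving (A2); the element that
    represents it is the gluing. *)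
Lemma Tset_glue A I (s : I -> A) :
  (forall i j, restr (s i) (extent (s j)) = restr (s j) (extent (s i))) ->
  exists z, extent z = bigjoin (range (fun i => extent (s i))) /\
            forall i, restr z (extent (s i)) = s i.
Proof.
move=> s_compat.
have sC i j y : Id (s i) y `&` extent (s j) = Id (s j) y `&` extent (s i).
  by rewrite -!Id_restr s_compat.
have [|z zE] := @Id_real d T A (fun y => bigjoin (range (fun i => Id (s i) y))).
  split=> x y.
    apply: bigjoin_meet_le => _ [i _ <-]; apply: le_trans (Id_trans _ _ _) _.
    by apply: bigjoin_ub; exists i.
  apply: bigjoin_meet_le => _ [i _ <-]; rewrite meetC.
  apply: bigjoin_meet_le => _ [j _ <-].
  apply: (@le_trans _ _ (Id x (s i) `&` Id (s i) y)); last exact: Id_trans.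
  rewrite lexI [Id x _]Id_sym leIr /=.
  apply: (@le_trans _ _ (Id (s j) y `&` extent (s i))).
    by apply: leI2 => //; apply: Id_le_extent.
  by rewrite sC leIl.
have zs i : restr z (extent (s i)) = s i.
  apply: Id_inj => y; rewrite Id_restr -zE; apply: le_anti; apply/andP; split.
    by apply: bigjoin_meet_le => _ [j _ <-]; rewrite sC leIl.
  by rewrite lexI Id_le_extent andbT; apply: bigjoin_ub; exists i.
exists z; split=> //; rewrite {1}/extent -zE; congr bigjoin.
apply: eq_imagel => i _.
by rewrite -{1}(zs i) Id_restr -[LHS](extent_restr z) zs.
Qed.

Lemma relation_eqP A B (f g : relation A B) : f =1 g -> f = g.
Proof. by move=> fg; apply/relation_ext/funext. Qed.

End TsetTheory.

(** [res_bigjoin] is separation, so [sheaf_glue] has only to assert existence. *)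
Record sheaf (d : Order.disp_t) (T : completeHeytingType d) := Sheaf {
  sections :> Type;
  dom : sections -> T;
  res : sections -> T -> sections;
  dom_res : forall x p, dom (res x p) = dom x `&` p;
  res_res : forall x p q, res (res x p) q = res x (p `&` q);
  res_dom : forall x, res x (dom x) = x;
  res_bigjoin : forall (S : set T) x y,
    (forall p, S p -> res x p = res y p) ->
    res x (bigjoin S) = res y (bigjoin S);
  sheaf_glue : forall I (s : I -> sections),
    (forall i j, res (s i) (dom (s j)) = res (s j) (dom (s i))) ->
    exists z, dom z = bigjoin (range (fun i => dom (s i))) /\
              forall i, res z (dom (s i)) = s i
}.

(** * The T-set of a sheaf *)

Section TsetOfSheaf.
Variables (d : Order.disp_t) (T : completeHeytingType d) (S : sheaf T).
Implicit Types (x y z : S) (p q : T).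

Definition agreement x y : T :=
  bigjoin [set p | [/\ p <= dom x, p <= dom y & res x p = res y p]].

(** By separation the join that defines [agreement] belongs to its own set, hence is a maximum. The
    laws of [Id] are read off from this description. *)
Lemma le_agreement x y p :
  p <= agreement x y <-> [/\ p <= dom x, p <= dom y & res x p = res y p].
Proof.
split=> [|pxy]; last exact: bigjoin_ub.
have xy : res x (agreement x y) = res y (agreement x y).
  by apply: res_bigjoin => q [].
move=> p_le; split.
- by apply: le_trans p_le _; apply: bigjoin_le => q [].
- by apply: le_trans p_le _; apply: bigjoin_le => q [].
- by rewrite -(meet_idPr p_le) -!res_res xy.
Qed.

Lemma agreementxx x : agreement x x = dom x.
Proof.
apply: eq_of_le => p; apply/idP/idP => [/le_agreement[]//|px].
exact/le_agreement.
Qed.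

Lemma agreement_sym x y : agreement x y = agreement y x.
Proof.
by apply: eq_of_le => p; apply/idP/idP => /le_agreement[? ? ?];
  apply/le_agreement.
Qed.

Lemma agreement_trans x y z : agreement x y `&` agreement y z <= agreement x z.
Proof.
have /le_agreement[px _ xy] := leIl (agreement x y) (agreement y z).
have /le_agreement[_ pz yz] := leIr (agreement y z) (agreement x y).
by apply/le_agreement; split=> //; rewrite xy.
Qed.

Lemma agreement_inj x x' : (forall y, agreement x y = agreement x' y) -> x = x'.
Proof.
move=> xx'; have xE : dom x = dom x'.
  apply/le_anti/andP; split.
    by rewrite -agreementxx xx'; have /le_agreement[] := lexx (agreement x' x).
  by rewrite -agreementxx -xx'; have /le_agreement[] := lexx (agreement x x').
have : dom x <= agreement x x' by rewrite xx' agreementxx xE.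
by case/le_agreement => _ _; rewrite res_dom xE res_dom.
Qed.

Lemma agreement_res x p y : agreement (res x p) y = agreement x y `&` p.
Proof.
apply: eq_of_le => q; rewrite lexI; apply/idP/andP.
  case/le_agreement; rewrite dom_res lexI res_res => /andP[qx qp] qy.
  by rewrite (meet_idPr qp) => xy; split=> //; apply/le_agreement.
case=> /le_agreement[qx qy xy] qp; apply/le_agreement; split=> //.
  by rewrite dom_res lexI qx.
by rewrite res_res (meet_idPr qp).
Qed.

(** The sections [res x (a x)], for all [x], are compatible by (A2), and their gluing represents
    [a]. *)
Lemma agreement_real (a : S -> T) : is_atom agreement a -> is_real agreement a.
Proof.
case=> a1 a2; have a_dom x : a x <= dom x.
  by rewrite -agreementxx -[leLHS]meetxx a2.
have domE x : dom (res x (a x)) = a x by rewrite dom_res; apply/meet_idPr.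
have [i j|z [zE zs]] := sheaf_glue (s := fun x => res x (a x)).
  have /le_agreement[_ _] := a2 i j.
  by rewrite !domE !res_res [a j `&` _]meetC.
exists z => y; apply/le_anti/andP; split.
  apply/le_agreement; split=> //.
    by rewrite zE; apply: bigjoin_ub; exists y.
  by have := zs y; rewrite domE.
(* Converse inequality: [dom z] is the join of the [a x], and [z] agrees with [x] on [a x], so (A1)
   from [x] to [y] concludes. *)
have /le_agreement[pz py zy] := lexx (agreement z y).
rewrite -[leLHS](meet_idPr pz) zE; apply: bigjoin_meet_le => _ [x _ <-].
rewrite domE; apply: le_trans (a1 x y); rewrite lexI leIl; apply/le_agreement.
split.
- by rewrite leIx2 // a_dom.
- by rewrite leIx2 // py orbT.
- by rewrite -[LHS]res_res -zs domE res_res meetC -!res_res zy.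
Qed.

Definition Tset_of_sheaf : Tset T :=
  TSet agreement_sym agreement_trans agreement_real agreement_inj.

Lemma extent_sheaf (x : Tset_of_sheaf) : extent x = dom x.
Proof. exact: agreementxx. Qed.

Lemma restr_sheaf (x : Tset_of_sheaf) p : restr x p = res (x : S) p.
Proof. by apply: Id_inj => y; rewrite Id_restr [RHS]agreement_res. Qed.

End TsetOfSheaf.

(** * Limits *)

Section Constructions.
Variables (d : Order.disp_t) (T : completeHeytingType d).
Implicit Types (A B W X Y Z : Tset T) (p q : T).

Lemma meet_bigjoin_eq (S : set T) p q :
  (forall r, S r -> p `&` r = q `&` r) -> p `&` bigjoin S = q `&` bigjoin S.
Proof.
move=> pq; rewrite !(meetC _ (bigjoin S)) !bigjoin_meetl; congr bigjoin.
by apply: eq_imagel => r Sr; rewrite !(meetC r) pq.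
Qed.

(** Mediating morphisms are specified below by what their values satisfy; uniqueness of the value
    makes the chosen function commute with restriction. *)
Lemma relation_of_graph A B (R : A -> B -> Prop) :
  (forall a, exists b, R a b) ->
  (forall a b b', R a b -> R a b' -> b = b') ->
  (forall a b, R a b -> extent b = extent a) ->
  (forall a b p, R a b -> R (restr a p) (restr b p)) ->
  exists h : relation A B, forall a, R a (h a).
Proof.
move=> /choice[h hR] R_fun R_extent R_restr.
have h_extent a : extent (h a) = extent a by apply: R_extent.
have h_restr a p : h (restr a p) = restr (h a) p.
  by apply: R_fun (hR _) _; apply: R_restr.
by exists (Relation h_extent h_restr).
Qed.

(** * Families of elements with a common domain *)

Section Families.
Variables (K : Type) (A : K -> Tset T) (P : (forall k, A k) -> Prop).

(** [fam_dom] is a separate field because the index type may be empty, and then no component carries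
    it. *)
Record family := Family {
  fam_dom : T;
  fam_val :> forall k, A k;
  fam_extent : forall k, extent (fam_val k) = fam_dom;
  fam_prop : P fam_val
}.

Lemma family_eq (x y : family) :
  fam_dom x = fam_dom y -> (forall k, x k = y k) -> x = y.
Proof.
case: x y => [e x xe xP] [e' y ye yP] /= ee' xyk.
have xy := functional_extensionality_dep xyk.
case: e' / ee' ye => ye; case: y / xy {xyk} ye yP => ye yP.
by congr Family; apply: Prop_irrelevance.
Qed.

(** Stability under restriction and locality: [P] cuts out a subsheaf of the product. *)
Hypothesis P_restr : forall x p, P x -> P (fun k => restr (x k) p).
Hypothesis P_local : forall (S : set T) x,
  (forall k, extent (x k) <= bigjoin S) ->
  (forall p, S p -> P (fun k => restr (x k) p)) -> P x.

Lemma family_res_extent (x : family) p k :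
  extent (restr (x k) p) = fam_dom x `&` p.
Proof. by rewrite extent_restr fam_extent. Qed.

Definition family_res (x : family) p : family :=
  Family (family_res_extent x p) (P_restr p (fam_prop x)).

Lemma family_glue I (s : I -> family) :
  (forall i j, family_res (s i) (fam_dom (s j)) =
               family_res (s j) (fam_dom (s i))) ->
  exists z, fam_dom z = bigjoin (range (fun i => fam_dom (s i))) /\
            forall i, family_res z (fam_dom (s i)) = s i.
Proof.
move=> s_compat.
have /all_sig[z zP] k : {z : A k |
    extent z = bigjoin (range (fun i => fam_dom (s i))) /\
    forall i, restr z (fam_dom (s i)) = s i k}.
  apply: cid; have [i j|z [zE zs]] := Tset_glue (s := fun i => s i k).
    by rewrite !fam_extent -[LHS]/(family_res (s i) (fam_dom (s j)) k) s_compat.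
  exists z; split=> [|i]; last by rewrite -[RHS]zs fam_extent.
  by rewrite zE; congr bigjoin; apply: eq_imagel => i _; rewrite fam_extent.
have z_extent k := (zP k).1.
have zs k := (zP k).2.
have Pz : P z.
  apply: (P_local (S := range (fun i => fam_dom (s i)))) => [k|_ [i _ <-]].
    by rewrite z_extent.
  have -> : (fun k => restr (z k) (fam_dom (s i))) = fam_val (s i).
    by apply: functional_extensionality_dep => k; apply: zs.
  exact: fam_prop.
exists (Family z_extent Pz); split=> // i; apply: family_eq => //=.
rewrite meetC; apply/meet_idPl/bigjoin_ub; exact: imageT.
Qed.

(** Left transparent: elements of [families] are later read as terms of type [family]. *)
Definition family_sheaf : sheaf T.
Proof.
refine (@Sheaf d T family fam_dom family_res _ _ _ _ family_glue) => //.
- move=> x p q; apply: family_eq => [|k] /=; first by rewrite meetA.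
  by rewrite restr_restr.
- move=> x; apply: family_eq => [|k] /=; first by rewrite meetxx.
  by rewrite -(fam_extent x k) restr_extent.
- move=> S x y xy; apply: family_eq => [|k] /=.
    by apply: meet_bigjoin_eq => p /xy /(congr1 fam_dom).
  by apply: restr_bigjoin => p /xy /(congr1 (fun z : family => z k)).
Defined.

Definition families : Tset T := Tset_of_sheaf family_sheaf.

Lemma families_proj_extent k (x : families) :
  extent ((x : family) k) = extent x.
Proof. by rewrite fam_extent extent_sheaf. Qed.

Lemma families_proj_restr k (x : families) p :
  (restr x p : family) k = restr ((x : family) k) p.
Proof. by rewrite restr_sheaf. Qed.

Definition families_proj k : relation families (A k) :=
  Relation (families_proj_extent k) (families_proj_restr k).

Lemma families_eq (x y : families) : extent x = extent y ->
  (forall k, families_proj k x = families_proj k y) -> x = y.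
Proof. by rewrite !extent_sheaf => ? ?; apply: family_eq. Qed.

Lemma families_exist p (x : forall k, A k) :
  (forall k, extent (x k) = p) -> P x ->
  exists z : families, extent z = p /\ forall k, families_proj k z = x k.
Proof.
by move=> xp Px; exists (Family xp Px); split=> //; rewrite extent_sheaf.
Qed.

Lemma families_prop (x : families) : P (fun k => families_proj k x).
Proof. exact: fam_prop. Qed.

End Families.

(** * Terminal object, pullbacks, products and general limits *)

Lemma terminal_exists : exists (t : Tset T),
  (forall p, exists x : t, extent x = p) /\
  (forall x y : t, extent x = extent y -> x = y).
Proof.
(* A family over the empty index type is just its domain, an element of [T]. *)
pose A (k : void) : Tset T := match k with end.
exists (@families void A (fun=> True) (fun _ _ _ => I) (fun _ _ _ _ => I)).
split=> [p|x y xy]; last exact: families_eq.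
have [//|//|x [xp _]] := @families_exist void A (fun=> True)
  (fun _ _ _ => I) (fun _ _ _ _ => I) p (fun k => match k with end).
by exists x.
Qed.

(** Relations preserve extents, so the only possible value at [x] is the element of [t] with the
    extent of [x]. *)
Lemma is_terminalP (t : Tset T) :
  (forall p, exists x : t, extent x = p) ->
  (forall x y : t, extent x = extent y -> x = y) ->
  is_terminal (t : Tset_category T).
Proof.
move=> t_ex t_eq X.
have [a|a b b' ab ab'|//|a b p|h _] :=
    @relation_of_graph X t (fun x y => extent y = extent x).
- exact: t_ex.
- by apply: t_eq; rewrite ab.
- by rewrite !extent_restr => ->.
exists h; split=> // h' _; apply: relation_eqP => x; apply: t_eq.
by rewrite !rel_extent.
Qed.

(** The pullback property on elements: [W] is in bijection with the pairs whose images in [Z]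
    coincide. *)
Definition cartesian_square X Y Z W (f : relation X Z) (g : relation Y Z)
    (p : relation W X) (q : relation W Y) : Prop :=
  [/\ forall w, f (p w) = g (q w),
      forall w w', p w = p w' -> q w = q w' -> w = w' &
      forall x y, f x = g y -> exists w, p w = x /\ q w = y].

Lemma cartesian_square_exists X Y Z (f : relation X Z) (g : relation Y Z) :
  exists W (p : relation W X) (q : relation W Y), cartesian_square f g p q.
Proof.
pose A b := if b then X else Y.
pose P (x : forall b, A b) := f (x true) = g (x false).
have P_restr x p : P x -> P (fun b => restr (x b) p).
  by rewrite /P !rel_restr => ->.
have P_local (S : set T) x : (forall k, extent (x k) <= bigjoin S) ->
    (forall p, S p -> P (fun k => restr (x k) p)) -> P x.
  move=> xS xP; apply: (eq_local (S := S)) => [||p /xP].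
  - by rewrite rel_extent; apply: (xS true).
  - by rewrite rel_extent; apply: (xS false).
  - by rewrite /P !rel_restr.
exists (families P_restr P_local), (families_proj P_restr P_local true).
exists (families_proj P_restr P_local false); split.
- by move=> w; apply: (families_prop w).
- move=> w w' ww'1 ww'2; apply: families_eq; last by case.
  by rewrite -(rel_extent (families_proj _ _ true)) ww'1 rel_extent.
- move=> x y fg.
  have xy : extent x = extent y by rewrite -(rel_extent f) fg rel_extent.
  pose z b : A b := if b return A b then x else y.
  have [||w [_ wz]] := families_exist P_restr P_local (p := extent x) (x := z).
  + by case.
  + exact: fg.
  by exists w; split; [apply: (wz true)|apply: (wz false)].
Qed.

Section Square.
Variables (X Y Z W : Tset T).
Variables (f : relation X Z) (g : relation Y Z).

Lemma cartesian_square_pullback (p : relation W X) (q : relation W Y) :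
  cartesian_square f g p q -> @is_pullback (Tset_category T) X Y Z W f g p q.
Proof.
case=> fg inj surj; split; first exact: relation_eqP.
move=> V u v fguv.
have [a|a b b' [<- <-] []|a b [pu _]|a b r [pu qv]|h hP] :=
    @relation_of_graph V W (fun a b => p b = u a /\ q b = v a).
- by apply: surj; apply: (congr1 (fun k : relation V Z => k a) fguv).
- by move=> pb qb; apply: inj.
- by rewrite -(rel_extent p) pu rel_extent.
- by rewrite !rel_restr pu qv.
exists h; split; first by split; apply: relation_eqP => a; case: (hP a).
move=> h' [pu qv]; apply: relation_eqP => a; case: (hP a) => pa qa.
by apply: inj; rewrite ?pa ?qa -1?pu -1?qv.
Qed.

End Square.

(** The given pullback is compared with the explicit one [V], whose description on elements carries
    over along the mediating morphisms. *)
Lemma pullback_cartesian_square X Y Z W (f : relation X Z) (g : relation Y Z)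
    (p : relation W X) (q : relation W Y) :
  @is_pullback (Tset_category T) X Y Z W f g p q -> cartesian_square f g p q.
Proof.
case=> fg univ.
have fgE w : f (p w) = g (q w).
  exact: (congr1 (fun k : relation W Z => k w) fg).
have [V [p' [q' sq]]] := cartesian_square_exists f g.
have [fg' univ'] := cartesian_square_pullback sq.
have [h [[/= ph qh] _]] := univ V p' q' fg'.
have [k [[/= pk qk] _]] := univ' W p q fg.
have [i [_ i_uniq]] := univ W p q fg.
have phE x : p (h x) = p' x := congr1 (fun r : relation V X => r x) ph.
have qhE x : q (h x) = q' x := congr1 (fun r : relation V Y => r x) qh.
have pkE w : p' (k w) = p w := congr1 (fun r : relation W X => r w) pk.
have qkE w : q' (k w) = q w := congr1 (fun r : relation W Y => r w) qk.
(* Both [h] after [k] and the identity mediate from [W] to itself. *)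
have hk : relation_comp h k = relation_id W.
  rewrite -(i_uniq (relation_comp h k)).
    by apply: i_uniq; split; apply: relation_eqP.
  by split; apply: relation_eqP => w /=; rewrite ?phE ?qhE.
have hkE w : h (k w) = w := congr1 (fun r : relation W W => r w) hk.
case: sq => _ inj surj; split=> // [w w' pw qw|x y /surj[v [<- <-]]].
  rewrite -(hkE w) -(hkE w'); congr (h _).
  by apply: inj; rewrite ?pkE ?qkE.
by exists (h v).
Qed.

(** The kernel pair of [m] has equal projections, and every pair identified by [m] comes from it. *)
Lemma monic_inj X Y (m : relation X Y) :
  @is_monic (Tset_category T) X Y m -> injective m.
Proof.
move=> m_monic x y mxy.
have [W [p [q [mpq _ surj]]]] := cartesian_square_exists m m.
have pq : p = q by apply: m_monic; apply: relation_eqP.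
by have [w [<- <-]] := surj x y mxy; rewrite pq.
Qed.

(** The elements of a product are the pairs of equal extent, not all pairs. *)
Definition product_cone X Y W (p : relation W X) (q : relation W Y) : Prop :=
  (forall w w', p w = p w' -> q w = q w' -> w = w') /\
  (forall x y, extent x = extent y -> exists w, p w = x /\ q w = y).

(* A product is a pullback over the terminal object, whose elements are
   determined by their extents. *)
Lemma is_productP X Y W (p : relation W X) (q : relation W Y) :
  @is_product (Tset_category T) X Y W p q <-> product_cone p q.
Proof.
have [t [t_ex t_eq]] := terminal_exists.
have t_term := is_terminalP t_ex t_eq.
have [f _] := t_term X; have [g _] := t_term Y.
have fgE V (u : relation V X) (v : relation V Y) :
    @comp (Tset_category T) _ _ _ f u = @comp (Tset_category T) _ _ _ g v.
  by apply: relation_eqP => w; apply: t_eq; rewrite !rel_extent.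
split=> [prod|[inj surj]].
  have [|_ inj surj] := @pullback_cartesian_square X Y t W f g p q.
    by split=> // V u v _; apply: prod.
  split=> // x y xy; apply: surj; apply: t_eq.
  by rewrite !rel_extent.
have [|_ univ] := @cartesian_square_pullback X Y t W f g p q.
  split=> // [w|x y fg]; first by apply: t_eq; rewrite !rel_extent.
  by apply: surj; rewrite -(rel_extent f) fg rel_extent.
by move=> V u v; apply: univ.
Qed.

Lemma product_cone_exists X Y :
  exists W (p : relation W X) (q : relation W Y), product_cone p q.
Proof.
have [t [t_ex t_eq]] := terminal_exists.
have t_term := is_terminalP t_ex t_eq.
have [f _] := t_term X; have [g _] := t_term Y.
have [W [p [q [_ inj surj]]]] := cartesian_square_exists f g.
exists W, p, q; split=> // x y xy; apply: surj; apply: t_eq.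
by rewrite !rel_extent.
Qed.

(* The vertices of [J] live in a universe above that of the carriers of T-sets,
   so the families are indexed by a small [K] meeting every isomorphism class
   of [J]. *)
Lemma limit_exists (J : category) (F : functor J (Tset_category T))
    (K : Type) (g : K -> J) (s : J -> K)
    (u : forall j, hom (g (s j)) j) (v : forall j, hom j (g (s j))) :
  (forall j, comp (u j) (v j) = idm j) ->
  exists (L : Tset_category T) (p : forall j, hom L (F j)), is_limit p.
Proof.
move=> uv.
pose A k : Tset T := F (g k).
pose Fm i j (w : hom i j) : relation (F i) (F j) := fmap F w.
have Fcomp i j k (w : hom j k) (w' : hom i j) x :
    Fm _ _ (comp w w') x = Fm _ _ w (Fm _ _ w' x).
  by rewrite /Fm fmap_comp.
have Fid i x : Fm i i (idm i) x = x by rewrite /Fm fmap_id.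
(* Compatibility is imposed along arrows between the representatives [g k] only; the other vertices
   are reached through [u]. *)
pose P (x : forall k, A k) := forall k k' w, Fm (g k) (g k') w (x k) = x k'.
have P_restr x p : P x -> P (fun b => restr (x b) p).
  by move=> Px k k' w; rewrite rel_restr Px.
have P_local (S : set T) x : (forall k, extent (x k) <= bigjoin S) ->
    (forall p, S p -> P (fun k => restr (x k) p)) -> P x.
  move=> xS xP k k' w; apply: (eq_local (S := S)); rewrite ?rel_extent ?xS//.
  by move=> p /xP; rewrite -rel_restr; apply.
pose L := families P_restr P_local.
pose pr k : relation L (A k) := families_proj P_restr P_local k.
have prP x k k' w : Fm (g k) (g k') w (pr k x) = pr k' x.
  exact: (families_prop x).
pose p j : relation L (F j) := relation_comp (Fm _ _ (u j)) (pr (s j)).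
exists L, p; split=> [i j w|X f f_cone].
  apply: relation_eqP => x; rewrite -[RHS]/(Fm _ _ (u j) (pr (s j) x)).
  rewrite -[LHS]/(Fm _ _ w (Fm _ _ (u i) (pr (s i) x))) -Fcomp.
  (* The arrow [w] is moved to the representatives by [u i] and [v j]; then [u j] cancels [v j]. *)
  rewrite -(prP x (s i) (s j) (comp (v j) (comp w (u i)))) -Fcomp.
  by rewrite compA uv comp_idl.
have fE i j (w : hom i j) x :
    Fm i j w ((f i : relation _ _) x) = (f j : relation _ _) x.
  by rewrite -(f_cone i j w).
have [x|x y y' yx y'x|x y yx|x y q yx|h hP] :=
    @relation_of_graph X L (fun x y =>
      extent y = extent x /\ forall k, pr k y = (f (g k) : relation X (A k)) x).
- apply: families_exist; first by move=> k; rewrite rel_extent.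
  by move=> k k' w; apply: fE.
- apply: families_eq; first by rewrite yx.1 y'x.1.
  by move=> k; rewrite [LHS]yx.2 [RHS]y'x.2.
- exact: yx.1.
- split=> [|k]; first by rewrite !extent_restr yx.1.
  by rewrite !rel_restr yx.2.
exists h; split=> [j|h' h'E].
  apply: relation_eqP => x; rewrite -[LHS]/(Fm _ _ (u j) (pr (s j) (h x))).
  by rewrite (hP x).2; apply: fE.
apply: relation_eqP => x; apply: families_eq; first by rewrite !rel_extent.
move=> k; rewrite [LHS](hP x).2 -(h'E (g k)).
(* [s (g k)] may differ from [k], but [u (g k)] is an arrow between representatives, so
   compatibility applies to it. *)
by rewrite -[LHS]/(Fm _ _ (u (g k)) (pr (s (g k)) (h' x))) prP.
Qed.

(** * Exponentials *)

Section Exponential.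
Variables (X Y : Tset T).

(* A partial morphism with domain [p], extended to all of [X] by
   [x |-> rho (x | p)]. *)
Record pmap := PMap {
  pmap_dom : T;
  pmap_fun :> X -> Y;
  pmap_extent : forall x, extent (pmap_fun x) = extent x `&` pmap_dom;
  pmap_restr : forall x p, pmap_fun (restr x p) = restr (pmap_fun x) p
}.

Lemma pmap_eq (r s : pmap) : pmap_dom r = pmap_dom s -> r =1 s -> r = s.
Proof.
case: r s => [e r re rP] [e' s se sP] /= ee' rs_eq.
have rs := funext rs_eq.
case: e' / ee' se => se; case: s / rs {rs_eq} se sP => se sP.
by congr PMap; apply: Prop_irrelevance.
Qed.

Lemma pmap_res_extent (r : pmap) p x :
  extent (restr (r x) p) = extent x `&` (pmap_dom r `&` p).
Proof. by rewrite extent_restr pmap_extent meetA. Qed.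

Lemma pmap_res_restr (r : pmap) p x q :
  restr (r (restr x q)) p = restr (restr (r x) p) q.
Proof. by rewrite pmap_restr !restr_restr meetC. Qed.

Definition pmap_res (r : pmap) p : pmap :=
  PMap (pmap_res_extent r p) (pmap_res_restr r p).

Lemma pmap_glue I (s : I -> pmap) :
  (forall i j, pmap_res (s i) (pmap_dom (s j)) =
               pmap_res (s j) (pmap_dom (s i))) ->
  exists z, pmap_dom z = bigjoin (range (fun i => pmap_dom (s i))) /\
            forall i, pmap_res z (pmap_dom (s i)) = s i.
Proof.
move=> s_compat; set D := range _.
have /choice[z zP] x : exists z : Y, extent z = extent x `&` bigjoin D /\
    forall i, restr z (pmap_dom (s i)) = s i x.
  have [i j|z [zE zs]] := Tset_glue (s := fun i => s i x).
    rewrite !pmap_extent ![extent x `&` _]meetC -!restr_restr.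
    by rewrite -[restr (s i x) _]/(pmap_res (s i) (pmap_dom (s j)) x) s_compat.
  have {}zE : extent z = extent x `&` bigjoin D.
    rewrite zE meetC bigjoin_range_meet; congr bigjoin.
    by apply: eq_imagel => i _; rewrite pmap_extent meetC.
  exists z; split=> // i; rewrite -[RHS]zs pmap_extent -restr_restr.
  by rewrite [restr z (extent x)]restr_ge// zE leIl.
(* Commutation with restriction is local, so it is checked on each [pmap_dom (s i)]. *)
have z_restr x p : z (restr x p) = restr (z x) p.
  have zD y : extent (z y) <= bigjoin D by rewrite (zP y).1 leIr.
  apply: (eq_local (S := D)) => //.
    by rewrite extent_restr leIx2 // zD.
  move=> _ [i _ <-]; rewrite (zP _).2 pmap_restr -(zP x).2.
  by rewrite !restr_restr meetC.
exists (PMap (fun x => (zP x).1) z_restr); split=> // i.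
apply: pmap_eq => [|x] /=; last exact: (zP x).2.
by rewrite meetC; apply/meet_idPl/bigjoin_ub; exact: imageT.
Qed.

Definition pmap_sheaf : sheaf T.
Proof.
refine (@Sheaf d T pmap pmap_dom pmap_res _ _ _ _ pmap_glue) => //.
- move=> r p q; apply: pmap_eq => [|x] /=; first by rewrite meetA.
  by rewrite restr_restr.
- move=> r; apply: pmap_eq => [|x] /=; first by rewrite meetxx.
  by rewrite restr_ge// pmap_extent leIr.
- move=> S r s rs; apply: pmap_eq => [|x] /=.
    by apply: meet_bigjoin_eq => p /rs /(congr1 pmap_dom).
  by apply: restr_bigjoin => p /rs /(congr1 (fun z : pmap => z x)).
Defined.

Definition exponential : Tset T := Tset_of_sheaf pmap_sheaf.

End Exponential.

(** Evaluation sends a pair [(r, x)] of common extent to [r x]. The transpose of [f] sends [w] to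
    the partial map with domain [extent w] that applies [f] to [w] and [x], each restricted to the
    extent of the other. *)
Lemma exponential_exists X Y :
  exists (E P : Tset_category T) (p1 : hom P E)
    (p2 : hom P (X : Tset_category T)) (ev : hom P (Y : Tset_category T)),
    is_exponential p1 p2 ev.
Proof.
pose E := exponential X Y.
have [P [p1 [p2 p12]]] := product_cone_exists E X.
have domE (r : E) : pmap_dom (r : pmap X Y) = extent r by rewrite extent_sheaf.
have ev_extent a : extent ((p1 a : pmap X Y) (p2 a)) = extent a.
  by rewrite pmap_extent domE !rel_extent meetxx.
have restrE (r : E) q x : (restr r q : pmap X Y) x = restr ((r : pmap X Y) x) q.
  by rewrite restr_sheaf.
have ev_restr a q : (p1 (restr a q) : pmap X Y) (p2 (restr a q)) =
    restr ((p1 a : pmap X Y) (p2 a)) q.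
  by rewrite !rel_restr restrE pmap_restr restr_restr meetxx.
pose ev : relation P Y := Relation ev_extent ev_restr.
exists E, P, p1, p2, ev; split; first exact/is_productP.
move=> W Q q1 q2 /is_productP[inj surj] f.
have pairE w x : extent (restr w (extent x)) = extent (restr x (extent w)).
  by rewrite !extent_restr meetC.
have /choice[pair pairP] (wx : W * X) : exists a,
    q1 a = restr wx.1 (extent wx.2) /\ q2 a = restr wx.2 (extent wx.1).
  exact: surj.
have pair1 w x : q1 (pair (w, x)) = restr w (extent x) := (pairP (w, x)).1.
have pair2 w x : q2 (pair (w, x)) = restr x (extent w) := (pairP (w, x)).2.
have pair_extent w x : extent (pair (w, x)) = extent w `&` extent x.
  by rewrite -(rel_extent q1) pair1 extent_restr.
have pair_restr1 w x p : pair (restr w p, x) = restr (pair (w, x)) p.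
  apply: inj; rewrite rel_restr ?pair1 ?pair2 ?extent_restr !restr_restr //.
  by rewrite meetC.
have pair_restr2 w x p : pair (w, restr x p) = restr (pair (w, x)) p.
  apply: inj; rewrite rel_restr ?pair1 ?pair2 ?extent_restr !restr_restr //.
  by rewrite meetC.
have g_extent w x : extent (f (pair (w, x))) = extent x `&` extent w.
  by rewrite rel_extent pair_extent meetC.
have g_restr w x p : f (pair (w, restr x p)) = restr (f (pair (w, x))) p.
  by rewrite pair_restr2 rel_restr.
pose g w : E := PMap (g_extent w) (g_restr w).
have gE w : extent (g w) = extent w by rewrite extent_sheaf.
have gR w p : g (restr w p) = restr (g w) p.
  rewrite restr_sheaf; apply: pmap_eq => [|x] /=; first by rewrite extent_restr.
  by rewrite pair_restr1 rel_restr.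
exists (Relation gE gR : relation W E); split.
  have pairK a : pair (q1 a, q2 a) = a.
    by apply: inj; rewrite ?pair1 ?pair2 restr_ge // !rel_extent.
  have [a|a b b' [b1 b2] [b'1 b'2]|a b [b1 _]|a b r [b1 b2]|h hP] :=
      @relation_of_graph Q P (fun a b => p1 b = g (q1 a) /\ p2 b = q2 a).
  - by apply: p12.2; rewrite gE !rel_extent.
  - by apply: p12.1; rewrite ?b1 ?b2.
  - by rewrite -(rel_extent p1) b1 gE rel_extent.
  - by rewrite !rel_restr gR b1 b2.
  exists h; split; apply: relation_eqP => a /=; case: (hP a) => // h1 h2.
  by rewrite h1 h2 /= pairK.
move=> g' [h [/= h1 h2 h3]]; apply: relation_eqP => w; apply: pmap_eq => /=.
  by rewrite domE rel_extent.
move=> x; rewrite -h3 /=.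
have -> : p1 (h (pair (w, x))) = g' (q1 (pair (w, x))).
  exact: (congr1 (fun k : relation Q E => k _) h1).
have -> : p2 (h (pair (w, x))) = q2 (pair (w, x)).
  exact: (congr1 (fun k : relation Q X => k _) h2).
(* The value [g' w x] already has extent below those of [w] and [x], so these restrictions leave it
   unchanged. *)
rewrite pair1 pair2 rel_restr restrE pmap_restr restr_restr restr_ge//.
by rewrite pmap_extent domE rel_extent meetC.
Qed.

(** * The subobject classifier *)

(** A truth value at stage [truth_dom], that is, an element of its principal down-set. *)
Record truth := Truth {
  truth_dom : T;
  truth_val : T;
  truth_le : truth_val <= truth_dom
}.

Lemma truth_eq x y :
  truth_dom x = truth_dom y -> truth_val x = truth_val y -> x = y.
Proof.
case: x y => [e p pe] [e' p' p'e] /= ee' pp'; case: e' / ee' p'e => p'e.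
by case: p' / pp' p'e => p'e; congr Truth; apply: Prop_irrelevance.
Qed.

Definition truth_res x q : truth := Truth (leI2 (truth_le x) (lexx q)).

Lemma truth_glue I (s : I -> truth) :
  (forall i j, truth_res (s i) (truth_dom (s j)) =
               truth_res (s j) (truth_dom (s i))) ->
  exists z, truth_dom z = bigjoin (range (fun i => truth_dom (s i))) /\
            forall i, truth_res z (truth_dom (s i)) = s i.
Proof.
move=> s_compat.
have z_le : bigjoin (range (fun i => truth_val (s i))) <=
            bigjoin (range (fun i => truth_dom (s i))).
  apply: bigjoin_le => _ [i _ <-]; apply: le_trans (truth_le _) _.
  by apply: bigjoin_ub; exact: imageT.
exists (Truth z_le); split=> // i; apply: truth_eq => /=.
  by rewrite meetC; apply/meet_idPl/bigjoin_ub; exact: imageT.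
apply/le_anti; rewrite lexI truth_le andbT; apply/andP; split; last first.
  by apply: bigjoin_ub; exact: imageT.
(* Compatibility turns [truth_val (s j)] cut to the domain of [s i] into [truth_val (s i)] cut to
   the domain of [s j]. *)
apply: bigjoin_meet_le => _ [j _ <-].
rewrite -[leLHS]/(truth_val (truth_res (s j) (truth_dom (s i)))) s_compat.
exact: leIl.
Qed.

Definition truth_sheaf : sheaf T.
Proof.
refine (@Sheaf d T truth truth_dom truth_res _ _ _ _ truth_glue) => //.
- by move=> x p q; apply: truth_eq; rewrite /= meetA.
- move=> x; apply: truth_eq; rewrite /= ?meetxx //.
  exact/meet_idPl/truth_le.
- move=> S x y xy; apply: truth_eq => /=; apply: meet_bigjoin_eq => p /xy.
    by move=> /(congr1 truth_dom).
  by move=> /(congr1 truth_val).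
Defined.

Definition Omega : Tset T := Tset_of_sheaf truth_sheaf.

(** [tr] picks the greatest truth value over each domain; [chi x] has as value the largest [p] below
    [extent x] such that [restr x p] lies in the image of [m]. *)
Lemma subobject_classifier_exists :
  has_subobject_classifier (Tset_category T).
Proof.
have [one [one_ex one_eq]] := terminal_exists.
have one_term := is_terminalP one_ex one_eq.
have tr_extent (x : one) : extent (Truth (lexx (extent x)) : Omega) = extent x.
  by rewrite extent_sheaf.
have tr_restr (x : one) p : Truth (lexx (extent (restr x p))) =
    restr (Truth (lexx (extent x)) : Omega) p.
  by rewrite restr_sheaf; apply: truth_eq; rewrite /= extent_restr.
pose tr : relation one Omega := Relation tr_extent tr_restr.
exists one, Omega, tr; split=> // U X m bang /monic_inj m_inj.
pose c x := bigjoin [set p | p <= extent x /\ exists v, m v = restr x p].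
have c_extent x : c x <= extent x by apply: bigjoin_le => p [].
(* The join is attained: injectivity of [m] makes the partial preimages compatible, and they
   glue. *)
have c_im x : exists v, m v = restr x (c x).
  pose I := {p | p <= extent x /\ exists v, m v = restr x p}.
  have /choice[s sE] (i : I) : exists v, m v = restr x (sval i).
    by case: i => p [].
  have s_extent i : extent (s i) = sval i.
    rewrite -(rel_extent m) sE extent_restr; apply/meet_idPr.
    by case: i => p [].
  have [i j|z [zE zs]] := Tset_glue (s := s).
    by apply: m_inj; rewrite !rel_restr !sE !s_extent !restr_restr meetC.
  exists z; have cE : c x = extent z.
    apply/le_anti/andP; split.
      apply: bigjoin_le => p px; rewrite zE; apply: bigjoin_ub.
      by exists (exist _ p px); rewrite ?s_extent.
    rewrite zE; apply: bigjoin_le => _ [i _ <-].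
    by rewrite s_extent; apply: bigjoin_ub; case: i.
  apply: (eq_local (S := [set p | p <= extent x /\
      exists v, m v = restr x p])).
  - by rewrite rel_extent -cE.
  - by rewrite extent_restr leIr.
  move=> p px; have := zs (exist _ p px); rewrite s_extent /= -rel_restr => ->.
  rewrite sE /= restr_restr; congr restr; apply/esym/meet_idPr.
  exact: bigjoin_ub.
have le_c x p : p <= c x <-> p <= extent x /\ exists v, m v = restr x p.
  split=> [pc|px]; last exact: bigjoin_ub.
  split; first exact: le_trans pc (c_extent x).
  have [v mv] := c_im x; exists (restr v p).
  by rewrite rel_restr mv restr_restr (meet_idPr pc).
have chi_extent x : extent (Truth (c_extent x) : Omega) = extent x.
  by rewrite extent_sheaf.
have chi_restr x p : Truth (c_extent (restr x p)) =
    restr (Truth (c_extent x) : Omega) p.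
  rewrite restr_sheaf; apply: truth_eq => /=; first by rewrite extent_restr.
  apply: eq_of_le => q; rewrite lexI; apply/idP/andP.
    case/le_c; rewrite extent_restr lexI restr_restr => /andP[qx qp].
    by rewrite (meet_idPr qp) => mq; split=> //; apply/le_c.
  case=> /le_c[qx mq] qp; apply/le_c; rewrite extent_restr lexI qx restr_restr.
  by rewrite (meet_idPr qp).
pose chi : relation X Omega := Relation chi_extent chi_restr.
exists chi; split.
  apply: cartesian_square_pullback; split.
  - move=> w; apply: truth_eq; rewrite /= !rel_extent //.
    apply/le_anti; rewrite -{1}(rel_extent m) c_extent /=.
    apply/le_c; rewrite rel_extent; split=> //; exists w.
    by rewrite restr_ge ?rel_extent.
  - by move=> w w' /m_inj.
  - move=> x e chi_e; have := congr1 truth_val chi_e.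
    have := congr1 truth_dom chi_e => /= xe cx; have [v mv] := c_im x.
    have mx : m v = x by rewrite mv cx -xe restr_extent.
    exists v; split=> //; apply: one_eq.
    by rewrite rel_extent -xe -mx rel_extent.
move=> chi' /pullback_cartesian_square[comm _ surj].
have chi'E x : truth_dom (chi' x) = extent x.
  by rewrite -(rel_extent chi') extent_sheaf.
apply: relation_eqP => x; apply: truth_eq => /=; first by rewrite chi'E.
(* For [p] below [extent x], commutativity and surjectivity of the square for [chi'] show that [p]
   is below the value of [chi' x] exactly when [restr x p] is in the image of [m]. *)
apply: eq_of_le => p; apply/idP/idP.
  case/le_c => px [v mv].
  have := comm v; rewrite mv rel_restr restr_sheaf => /(congr1 truth_val) /=.
  rewrite rel_extent -(rel_extent m) mv extent_restr (meet_idPr px) => <-.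
  exact: leIl.
move=> pc; have px : p <= extent x.
  by rewrite -chi'E; apply: le_trans pc (truth_le _).
apply/le_c; split=> //.
(* Since [e] has extent [p], [tr e] is the pair [(p, p)], which is also [chi' x] restricted to
   [p]. *)
have [e eE] := one_ex p.
have [|v [mv _]] := surj (restr x p) e; last by exists v.
rewrite rel_restr restr_sheaf; apply: truth_eq; rewrite /= eE ?chi'E.
  exact/meet_idPr.
exact/meet_idPr.
Qed.

(** * Finite limits by a small index type *)

Definition hom_of_eq (C : category) (i j : C) (e : i = j) : hom i j :=
  match e in _ = k return hom i k with erefl => idm i end.

Lemma hom_of_eqK (C : category) (i j : C) (e : i = j) :
  comp (hom_of_eq e) (hom_of_eq (esym e)) = idm j.
Proof. by case: j / e; apply: comp_idl. Qed.

(** Iterating [option] from [void] along the list stays in [Set], whatever the universe of [J]. *)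
Lemma list_small_cover (J : Type) (l : list J) :
  exists (K : Set) (g : K -> J), forall j, List.In j l -> exists k, g k = j.
Proof.
elim: l => [|j l [K [g gP]]]; first by exists void, (@of_void J).
exists (option K), (fun k => if k is Some k' then g k' else j) => i /= [<-|].
  by exists None.
by case/gP => k <-; exists (Some k).
Qed.

(** A section [s] of the cover [g] is chosen, and the equalities [g (s j) = j] yield the arrows [u]
    and [v] of [limit_exists]. *)
Lemma finite_limits_exist : has_finite_limits (Tset_category T).
Proof.
move=> J F [[l l_full] _].
have [K [g gP]] := list_small_cover l.
have sec j : {k | g k = j} by apply: cid; apply: gP; apply: l_full.
pose s j := sval (sec j).
have gs j : g (s j) = j := svalP (sec j).
apply: (@limit_exists J F K g s (fun j => hom_of_eq (gs j))
  (fun j => hom_of_eq (esym (gs j)))) => j.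
exact: hom_of_eqK.
Qed.

End Constructions.

Theorem mainTheorem1 (d : Order.disp_t) (T : completeHeytingType d) :
  elementary_topos (Tset_category T) /\
  has_pullbacks (Tset_category T) /\
  has_exponentials (Tset_category T).
Proof.
have exps : has_exponentials (Tset_category T).
  by move=> X Y; apply: exponential_exists.
split; last split=> //.
  split; [exact: finite_limits_exist| |exact: subobject_classifier_exists].
  split=> //.
    have [t [t_ex t_eq]] := terminal_exists T.
    by exists t; apply: is_terminalP.
  move=> X Y; have [W [p [q pq]]] := product_cone_exists X Y.
  by exists W, p, q; apply/is_productP.
move=> X Y Z f g; have [W [p [q pq]]] := cartesian_square_exists f g.
by exists W, p, q; apply: cartesian_square_pullback.
Qed.
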